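(* Let $f$ be a measurable (complex-valued) function on $\mathbb{R}$ which is nonnegative, or is in $L^1(\mathbb{R})$, or has bounded support. If $\alpha,\beta>0$ are rationally independent real numbers and $$\sum_{k\in\mathbb{Z}} f(x-k\alpha)=p,\qquad \sum_{k\in\mathbb{Z}} f(x-k\beta)=q\qquad\text{for a.e. } x\in\mathbb{R},$$ with both series converging absolutely for a.e. $x$, for some nonzero vector $(p,q)\in\mathbb{C}^2$, then $(p,q)$ is proportional to $(\beta,\alpha)$ and $\operatorname{mes}(\operatorname{supp} f)\ge\alpha+\beta$.
   Context: Two positive real numbers $\alpha,\beta$ are rationally independent if $n\alpha+m\beta=0$ with $n,m\in\mathbb{Z}$ implies $n=m=0$ (equivalently, $\alpha/\beta$ is irrational). The support of a function $f$ is the set $\operatorname{supp} f=\{x: f(x)\ne 0\}$ (no closure is taken). $\operatorname{mes}$ denotes Lebesgue measure on $\mathbb{R}$. A vector $u\in\mathbb{C}^2$ is said to be proportional to a vector $v$ if $u=\lambda v$ for some scalar $\lambda\in\mathbb{C}$. *)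

(* Defs.v *)
From HB Require Import structures.
From mathcomp Require Import all_boot all_order all_algebra finmap.
From mathcomp Require Import all_classical all_reals all_analysis.
From mathcomp Require summability.
From mathcomp Require Export complex.
Set Implicit Arguments.
Unset Strict Implicit.
Unset Printing Implicit Defensive.
Import Order.TTheory GRing.Theory Num.Theory.
Import numFieldNormedType.Exports.
Local Open Scope classical_set_scope.
Local Open Scope ring_scope.

(* The real line with the Lebesgue (not merely Borel) sigma-algebra, i.e. the
   domain of completed_lebesgue_measure. *)
Notation lebesgueTypeR R := (caratheodory_type ((@wlength R idfun)^*)%mu).

Notation mes := completed_lebesgue_measure.

Section Definitions.
Context {R : realType}.
Implicit Types (f : R -> R[i]) (a b : R) (p q : R[i]).

Definition lebesgue_measurable f : Prop :=
  measurable_fun [set: lebesgueTypeR R] (fun x => complex.Re (f x) : R) /\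
  measurable_fun [set: lebesgueTypeR R] (fun x => complex.Im (f x) : R).

(* Normc.normc is the R-valued modulus; the norm of R[i] itself takes values
   in R[i]. *)
Definition in_L1 f : Prop :=
  lebesgue_measurable f /\
  mes.-integrable [set: lebesgueTypeR R] (fun x => (ComplexField.Normc.normc (f x))%:E).

Definition supp f : set R := [set x | f x != 0].

Definition absolutely_convergent (u : int -> R[i]) : Prop :=
  summable [set: int] (fun k => (ComplexField.Normc.normc (u k))%:E).

(* Limit along the net of finite subsets of the index set, so that no
   enumeration of the integers is chosen. *)
Definition sums_to (u : int -> R[i]) (s : R[i]) : Prop :=
  @summability.partial_sum int R[i] u @ summability.totally --> (s : R[i]^o).

Definition sum_translates_ae f a p : Prop :=
  \forall x \ae (@mes R),
    let u := fun k : int => f ((x : R) - k%:~R * a) in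
    absolutely_convergent u /\ sums_to u p.

Definition rationally_independent a b : Prop :=
  forall n m : int, n%:~R * a + m%:~R * b = 0 -> n = 0 /\ m = 0.

Definition proportional (u v : R[i] * R[i]) : Prop :=
  exists c : R[i], u.1 = c * v.1 /\ u.2 = c * v.2.

End Definitions.

(* Main.v *)
Require Import Defs.
From HB Require Import structures.
From mathcomp Require Import all_boot all_order all_algebra finmap.
From mathcomp Require Import all_classical all_reals all_analysis.
From mathcomp Require Import measurable_realfun zify ring lra.
Set Implicit Arguments.
Unset Strict Implicit.
Unset Printing Implicit Defensive.
Import Order.TTheory GRing.Theory Num.Theory.
Import numFieldNormedType.Exports.
Local Open Scope classical_set_scope.
Local Open Scope ring_scope.

(** Taking real and imaginary parts and discarding a null set, one may assume
    that [f] is a real Borel function that tiles everywhere on a conull set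
    [Om] invariant under both translations.

    Levels.  Integrating the tiling identity over a period gives
    [p a = q b] for nonnegative or integrable [f] (then [p a] and [q b] are
    both the integral of [f]).  For a measurable [f] of bounded support,
    subtract a trapezoid with levels [(p, p a / b)]: the difference [v] has
    levels [(0, r)] with [r = q - p a / b].  Level 0 along [a] makes [v] a
    difference [g - g(. - a)] with [g] of bounded support, and then the
    [b]-periodization [G] of [g] satisfies [G (x - a) = G x - r].  If [r] were
    nonzero, the sets [floor (G / r) = n] would cut the circle R/bZ into
    infinitely many sets of equal measure.

    Measure of the support.  View each point of the support as an edge joining
    its class in R/aZ to its class in R/bZ, so that edges have total measure
    [mes (supp f)] and vertices have total measure [a + b].  Remove
    simultaneously all edges having an endpoint of degree one, and iterate.
    The sum of [f] over the surviving edges at a surviving vertex of R/aZ is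
    always of the form [(n+1) p - m q], and symmetrically on the other side;
    since [p / q] is irrational, such a sum is nonzero, and an edge cannot be
    the only one at both of its endpoints.  Hence each removal deletes as much
    vertex measure as edge measure.  If the edges had measure [d] less than the
    vertices, double counting of degrees would give leaves of measure at least
    [2 d] at every stage, and the edge measure would become negative. *)

(** * Translation invariance of Lebesgue measure and of integrals *)

Section Translation.
Context {R : realType}.
Local Notation mu := (@lebesgue_measure R).
Implicit Types (t : R) (A : set R).

Lemma measurable_shift t : measurable_fun setT (fun x : R => x + t).
Proof. exact: measurable_funD. Qed.

Lemma measurable_preimage_shift t A : measurable A ->
  measurable [set x | A (x + t)].
Proof.
by move=> mA; rewrite -[X in measurable X]setTI; exact: measurable_shift.
Qed.

(** The pushforward of [mu] under the shift agrees with [mu] on half-open intervals, and these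
    determine the measure. *)
Lemma lebesgue_measure_shift t A : measurable A ->
  mu [set x | A (x + t)] = mu A.
Proof.
have itv_shift (a b : R) :
    mu [set x | `]a, b]%classic (x + t)] = mu `]a, b]%classic.
  rewrite (_ : [set x | _] = `]a - t, b - t]%classic); last first.
    by apply/seteqP; split => x /=; rewrite !in_itv/= ltrBlDr lerBrDr.
  rewrite !lebesgue_measure_itv/= !lte_fin ltrD2r.
  by case: ifP => // _; rewrite -!EFinB opprB subrKA.
move=> mA.
pose phi : measurableTypeR R -> measurableTypeR R := fun x => x + t.
have mphi : measurable_fun setT phi by exact: measurable_shift.
pose mphi_mixin := isMeasurableFun.Build _ _ _ _ _ mphi.
pose mphi_pack : {mfun _ >-> _} := HB.pack phi mphi_mixin.
apply/esym/(@lebesgue_measure_unique _ (pushforward mu mphi_pack)) => //.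
by move=> _ [[a b]] _ <-; exact/esym/itv_shift.
Qed.

Lemma ge0_integral_shift t (D : set R) (g : R -> \bar R) : measurable D ->
  measurable_fun setT g -> (forall x, 0 <= g x)%E ->
  (\int[mu]_(x in D) g x =
   \int[mu]_(x in [set x | D (x + t)%R]) g (x + t)%R)%E.
Proof.
move=> mD mg g0.
pose phi : measurableTypeR R -> measurableTypeR R := fun x => x + t.
have mphi : measurable_fun setT phi by exact: measurable_shift.
rewrite -[RHS]/(\int[mu]_(x in phi @^-1` D) (g \o phi) x)%E.
rewrite -(ge0_integral_pushforward mphi)//; last exact: measurable_funS mg.
by apply: eq_measure_integral => A mA _; exact/esym/lebesgue_measure_shift.
Qed.

End Translation.

(** * Enumeration of the integers, turning sums over them into series *)

Section IntEnum.

Definition int_enum (n : nat) : int :=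
  if odd n then Negz n./2 else Posz n./2.

Lemma int_enum_bij : set_bij [set: nat] [set: int] int_enum.
Proof.
split => //.
- move=> m n _ _; rewrite /int_enum.
  case: (boolP (odd m)) => om; case: (boolP (odd n)) => on //= [] mn;
  by rewrite -(odd_double_half m) -(odd_double_half n) mn
    ?om ?on ?(negbTE om) ?(negbTE on).
- move=> [n|n] _ /=.
    by exists n.*2 => //; rewrite /int_enum odd_double doubleK.
  by exists n.*2.+1 => //; rewrite /int_enum/= odd_double uphalf_double.
Qed.

Lemma esum_int (R : realType) (h : int -> \bar R) : (forall k, 0 <= h k)%E ->
  (\esum_(k in [set: int]) h k = \sum_(n <oo) h (int_enum n))%E.
Proof.
move=> h0; by rewrite (reindex_esum _ _ _ _ int_enum_bij) nneseries_esumT.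
Qed.

End IntEnum.

(** * Folding the line onto one period *)

Section Fold.
Context {R : realType}.
Local Notation mu := (@lebesgue_measure R).
Implicit Types (a : R).


Lemma sub_floor_itv a (x : R) : 0 < a ->
  `[0, a[%classic (x - (Num.floor (x / a))%:~R * a).
Proof.
move=> a0 /=; rewrite in_itv/= subr_ge0 -ler_pdivlMr// floor_le/=.
by rewrite ltrBlDl -[X in _ + X]mul1r -mulrDl -ltr_pdivrMr// -intrD1 floorD1_gt.
Qed.

Lemma itv_floor a (x : R) (k : int) : 0 < a ->
  `[0, a[%classic (x - k%:~R * a) -> k = Num.floor (x / a).
Proof.
move=> a0; rewrite /= in_itv/= subr_ge0 -ler_pdivlMr// => /andP[h1 h2].
apply/esym/eqP; rewrite floor_eq h1/= intrD1 ltr_pdivrMr// mulrDl mul1r addrC.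
by rewrite -ltrBlDr.
Qed.

Definition shift_itv a (k : int) : set R :=
  [set x | `[0, a[%classic (x - k%:~R * a)].

Lemma measurable_shift_itv a k : measurable (shift_itv a k).
Proof.
exact: (measurable_preimage_shift (- (k%:~R * a)) (measurable_itv _)).
Qed.

Lemma trivIset_shift_itv a : 0 < a ->
  trivIset setT (fun n => shift_itv a (- int_enum n)).
Proof.
move=> a0 m n _ _ [x [/(itv_floor a0) xm /(itv_floor a0) xn]].
have [_ inj _] := int_enum_bij.
by apply: inj; rewrite ?inE//; apply: oppr_inj; rewrite xm xn.
Qed.

Lemma bigcup_shift_itv a : 0 < a ->
  \bigcup_n shift_itv a (- int_enum n) = setT.
Proof.
move=> a0; apply/seteqP; split => // x _.
have [_ _ /(_ (- Num.floor (x / a)) I)[n _ nk]] := int_enum_bij.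
by exists n => //; rewrite nk opprK; exact: sub_floor_itv.
Qed.

Lemma measurable_fold a (g : R -> \bar R) : measurable_fun setT g ->
  (forall x, 0 <= g x)%E ->
  measurable_fun setT (fun x : R => \esum_(k in [set: int]) g (x - k%:~R * a)%R)%E.
Proof.
move=> mg g0.
under eq_fun do rewrite esum_int//.
apply: ge0_emeasurable_sum => // n _.
by apply: (measurableT_comp mg); exact: measurable_shift.
Qed.

(** The periods [shift_itv a (- k)] partition the line; translating each onto [[0, a[] turns [g x]
    into [g (x - k a)], and Tonelli exchanges sum and integral. *)
Lemma integral_fold a (g : R -> \bar R) : 0 < a -> measurable_fun setT g ->
  (forall x, 0 <= g x)%E ->
  (\int[mu]_x g x =
   \int[mu]_(x in `[0%R, a[) \esum_(k in [set: int]) g (x - k%:~R * a)%R)%E.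
Proof.
move=> a0 mg g0.
under [RHS]eq_integral do rewrite esum_int//.
rewrite integral_nneseries//; last first.
  move=> n; apply: measurable_funTS.
  by apply: (measurableT_comp mg); exact: measurable_shift.
rewrite -[in LHS](bigcup_shift_itv a0) ge0_integral_bigcup//; last 3 first.
- by move=> k; exact: measurable_shift_itv.
- exact: measurable_funTS.
- exact: trivIset_shift_itv.
apply: eq_eseriesr => n _.
rewrite (@ge0_integral_shift _ (- (int_enum n)%:~R * a))//; last first.
  exact: measurable_shift_itv.
rewrite mulNr (_ : [set x | _] = `[0, a[%classic)//.
by apply/seteqP; split => x; rewrite /shift_itv/= mulrNz mulNr opprK subrK.
Qed.

End Fold.

(** * Invariant conull sets, fibers and degrees *)

Section Invariant.
Context {R : realType}.
Local Notation mu := (@lebesgue_measure R).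
Implicit Types (a b x t : R) (A E P N : set R).

Definition periodic a P := forall x (k : int), P x -> P (x - k%:~R * a).

Lemma periodicE a P x (k : int) : periodic a P -> P (x - k%:~R * a) = P x.
Proof.
move=> Pa; apply/propext; split=> [/(Pa _ (- k))|]; last exact: Pa.
by rewrite mulrNz mulNr opprK subrK.
Qed.

(** The translates of [N] by all [m a + n b] form a countable family of null sets with invariant
    union; [Om] is its complement. *)
Lemma conull_invariant a b N : measurable N -> mu N = 0%E ->
  exists Om : set R, [/\ measurable Om, mu (~` Om) = 0%E, periodic a Om,
    periodic b Om & forall x, Om x -> ~ N x].
Proof.
move=> mN N0.
pose sh (m n : int) : set R := [set x | N (x + (- (m%:~R * a) - n%:~R * b))].
(* Pairs of integers are indexed by naturals; a code of no pair contributes the empty set. *)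
pose F j := if choice.unpickle j is Some mn then sh mn.1 mn.2 else set0.
have mF j : measurable (F j).
  by rewrite /F; case: choice.unpickle => // -[m n]; exact: measurable_preimage_shift.
have F0 j : mu (F j) = 0%E.
  rewrite /F; case: choice.unpickle => [[m n]|]; last exact: measure0.
  by rewrite lebesgue_measure_shift.
have FP x : (\bigcup_j F j) x <-> exists m n, sh m n x.
  split=> [[j _]|[m [n xmn]]].
    by rewrite /F; case: choice.unpickle => // -[m n] /=; exists m, n.
  by exists (choice.pickle (m, n)) => //; rewrite /F choice.pickleK.
exists (~` \bigcup_j F j); split.
- exact/measurableC/bigcupT_measurable.
- rewrite setCK.
  apply: measure_negligible; first exact: bigcupT_measurable.
  by apply: negligible_bigcup => j; exists (F j); split; [exact: mF|exact: F0|].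
- move=> x k + /FP[m [n]]; apply: contra_not => h.
  apply/FP; exists (m + k), n; move: h; rewrite /sh/=; congr N.
  by rewrite intrD; ring.
- move=> x k + /FP[m [n]]; apply: contra_not => h.
  apply/FP; exists m, (n + k); move: h; rewrite /sh/=; congr N.
  by rewrite intrD; ring.
- move=> x + Nx; apply; apply/FP; exists 0, 0.
  by rewrite /sh/= !mul0r oppr0 !addr0.
Qed.

(** Here [x] represents the vertex given by its class modulo [a], and the fiber indexes the edges at
    that vertex. *)
Definition fiber a E x : set int := [set k | E (x - k%:~R * a)].

Definition degree a E x : \bar R :=
  \esum_(k in [set: int]) (\1_E (x - k%:~R * a))%:E.

Lemma degree_ge0 a E x : (0 <= degree a E x)%E.
Proof. by apply: esum_ge0 => k _; rewrite lee_fin. Qed.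

Lemma measurable_degree a E : measurable E -> measurable_fun setT (degree a E).
Proof.
move=> mE; apply: (@measurable_fold _ a (fun x => (\1_E x)%:E)).
  exact/measurable_EFinP.
by move=> x; rewrite lee_fin.
Qed.

(** Double counting of edges: [integral_fold] applied to the indicator of [E]. *)
Lemma measure_fold a E : 0 < a -> measurable E ->
  (mu E = \int[mu]_(x in `[0%R, a[) degree a E x)%E.
Proof.
move=> a0 mE; rewrite -[E in LHS]setIT -integral_indic//.
apply: (@integral_fold _ a (fun x => (\1_E x)%:E) a0).
  exact/measurable_EFinP.
by move=> x; rewrite lee_fin.
Qed.

Lemma fiber_shift a E x (l k : int) :
  fiber a E (x - l%:~R * a) k <-> fiber a E x (l + k).
Proof. by rewrite /fiber/= intrD mulrDl opprD addrA. Qed.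

Lemma finite_fiber_shift a E x (k : int) :
  finite_set (fiber a E (x - k%:~R * a)) -> finite_set (fiber a E x).
Proof.
move=> fx; have -> : fiber a E x = (fun l => k + l) @` fiber a E (x - k%:~R * a).
  apply/seteqP; split=> [l xl|_ [l xl <-]]; last exact/fiber_shift.
  by exists (l - k); [apply/fiber_shift|]; rewrite addrC subrK.
exact: finite_image.
Qed.

Lemma degreeE a E x : degree a E x = (\esum_(k in fiber a E x) 1)%E.
Proof.
rewrite [RHS]esum_mkcond; apply: eq_esum => k _; rewrite indicE.
have -> : (x - k%:~R * a \in E) = (k \in fiber a E x).
  by apply/idP/idP; rewrite !inE.
by case: ifP.
Qed.

Lemma degree_set0 a E x : fiber a E x = set0 -> degree a E x = 0%E.
Proof. by rewrite degreeE => ->; rewrite esum_set0. Qed.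

Lemma degree_set1 a E x k : fiber a E x = [set k] -> degree a E x = 1%E.
Proof. by rewrite degreeE => ->; rewrite esum_set1. Qed.

Lemma degree_ge2 a E x k l : fiber a E x k -> fiber a E x l -> k != l ->
  (2 <= degree a E x)%E.
Proof.
move=> xk xl kl; rewrite degreeE; apply: esum_ge; exists [set k; l].
  by split=> [|_ [] -> //]; exact: finite_set2.
rewrite fsbigU//=; last by move=> z [-> /= zl]; move: kl; rewrite zl eqxx.
by rewrite !fsbig_set1.
Qed.

(** An infinite fiber has finite subsets of every size, and each of them bounds the degree from
    below. *)
Lemma degree_fin a E x : (degree a E x < +oo)%E -> finite_set (fiber a E x).
Proof.
rewrite degreeE; apply: contraPP => /infinite_set_fset h.
suff -> : (\esum_(k in fiber a E x) 1 = +oo :> \bar R)%E by rewrite ltxx.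
apply: eq_infty => r.
have [B Bs MB] := h (Num.truncn r).+1.
apply: (@le_trans _ _ (#|` B|%:R)%:E).
  rewrite lee_fin (le_trans (ltW (truncnS_gt _)))// ler_nat.
  exact: MB.
apply: esum_ge; exists [set` B]; first by split.
by rewrite fsbig_finite//= set_fsetK -sum1_size natr_sum -sumEFin.
Qed.

End Invariant.

(** * Vertices of positive degree and of degree one *)

Section Leaves.
Context {R : realType}.
Local Notation mu := (@lebesgue_measure R).
Implicit Types (a b x t : R) (A E P N : set R).

(** The left side is the measure of [P] in the period [[t, t + a[]. Every class modulo [a] meets
    that period exactly once, so folding gives the indicator of [P]. *)
Lemma periodic_measure_shift a P t : 0 < a -> measurable P -> periodic a P ->
  mu ([set x | P (x + t)] `&` `[0, a[) = mu (P `&` `[0, a[).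
Proof.
move=> a0 mP aP.
pose J : set R := [set y | `[0, a[%classic (y - t)].
have mJ : measurable J by exact: measurable_preimage_shift.
transitivity (mu (P `&` J)).
  rewrite -(lebesgue_measure_shift t (measurableI _ _ mP mJ)); congr mu.
  by apply/seteqP; split => x; rewrite /J/= addrK.
rewrite (measure_fold a0 (measurableI _ _ mP mJ)) -integral_indic//.
apply: eq_integral => x _; rewrite indicE.
have [Px|nPx] := pselect (P x).
  rewrite mem_set// (@degree_set1 _ _ _ _ (Num.floor ((x - t) / a)))//.
  apply/seteqP; split=> [k [_]|k ->].
    by rewrite /J/= addrAC => /(itv_floor a0).
  split; first by rewrite periodicE.
  by rewrite /J/= addrAC; exact: sub_floor_itv.
rewrite memNset// degree_set0//; apply/seteqP; split => // k [].
by rewrite periodicE.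
Qed.

Definition alive a E : set R := [set x | fiber a E x !=set0].

Definition leaf a E : set R := [set x | exists k, fiber a E x = [set k]].

Lemma leaf_alive a E : leaf a E `<=` alive a E.
Proof. by move=> x [k xk]; exists k; rewrite xk. Qed.

Lemma periodic_leaf a E : periodic a (leaf a E).
Proof.
move=> x k [l xl]; exists (l - k); apply/seteqP; split => m /=.
  by move/fiber_shift; rewrite xl => <-; rewrite addrAC subrr add0r.
by move=> ->; apply/fiber_shift; rewrite addrC subrK xl.
Qed.

(** Zero, one, or several edges at a vertex; the last case keeps two distinct edges as witnesses. *)
Variant fiber_spec a E x : \bar R -> bool -> bool -> Prop :=
| FiberEmpty of fiber a E x = set0 : fiber_spec a E x 0%E false false
| FiberSingle k of fiber a E x = [set k] : fiber_spec a E x 1%E true true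
| FiberMany (d : \bar R) k l of fiber a E x k & fiber a E x l & k != l &
    (2 <= d)%E : fiber_spec a E x d true false.

Lemma fiberP a E x :
  fiber_spec a E x (degree a E x) (x \in alive a E) (x \in leaf a E).
Proof.
have [[k xk]|] := pselect (fiber a E x !=set0); last first.
  move=> /set0P/negP/negPn/eqP x0; rewrite degree_set0// !memNset//.
  - by constructor.
  - by move=> [k]; rewrite x0 => /seteqP[_ /(_ k erefl)].
  - by rewrite /alive/= x0 => -[].
have xa : x \in alive a E by rewrite inE; exists k.
rewrite xa.
have [xE|/eqP] := pselect (fiber a E x = [set k]).
  by rewrite mem_set//; [rewrite (degree_set1 xE); exact: FiberSingle xE | exists k].
move=> /eqP/seteqP => h.
have [l xl lk] : exists2 l, fiber a E x l & k != l.
  apply: contrapT => nl; apply: h; split=> [l xl|l -> //].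
  by apply: contrapT => lk; apply: nl; exists l => //; apply/eqP => /esym.
rewrite memNset; first exact: (FiberMany xk xl lk (degree_ge2 xk xl lk)).
by move=> [m xm]; move: xk xl lk; rewrite xm => -> ->; rewrite eqxx.
Qed.

Lemma measurable_alive a E : measurable E -> measurable (alive a E).
Proof.
move=> mE; rewrite (_ : alive a E = setT `&` degree a E @^-1` (~` [set 0%E])).
  by apply: measurable_degree => //; exact: measurableC.
rewrite setTI; apply/seteqP; split => x.
  move=> /mem_set /=; case: fiberP => // [k _|d k l _ _ _ d2] _.
    exact/eqP/oner_neq0.
  by move=> d0; rewrite d0 lee_fin leNgt ltr0n in d2.
by move=> /= h; apply/set_mem; move: h; case: fiberP.
Qed.

Lemma measurable_leaf a E : measurable E -> measurable (leaf a E).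
Proof.
move=> mE; rewrite (_ : leaf a E = setT `&` degree a E @^-1` [set 1%E]).
  by apply: measurable_degree => //; exact: emeasurable_set1.
rewrite setTI; apply/seteqP; split => x.
  by move=> /mem_set /=; case: fiberP.
move=> /= h; apply/set_mem; move: h; case: fiberP => //.
  by move=> _ /esym/eqP; rewrite onee_eq0.
by move=> d k l _ _ _ + d1; rewrite d1 lee_fin leNgt ltr1n.
Qed.

(** Each leaf carries exactly one edge, so the degree of [E] restricted to leaves is the indicator
    of the leaves. *)
Lemma measure_leaf a E : 0 < a -> measurable E ->
  mu (E `&` leaf a E) = mu (leaf a E `&` `[0, a[).
Proof.
move=> a0 mE; have mL := measurable_leaf a mE.
rewrite (measure_fold a0 (measurableI _ _ mE mL)) -integral_indic//.
apply: eq_integral => x _; rewrite indicE.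
have [Lx|nLx] := pselect (leaf a E x).
  rewrite mem_set//; case: (Lx) => k xk; apply: (@degree_set1 _ _ _ _ k).
  rewrite -xk; apply/seteqP; split=> [l []//|l xl]; split => //.
  exact: periodic_leaf.
rewrite memNset// degree_set0//; apply/seteqP; split => // k [_].
by rewrite periodicE//; exact: periodic_leaf.
Qed.

(** Integrated form of a pointwise bound: twice the indicator of positive degree is at most the
    degree plus the indicator of degree one. *)
Lemma le_alive_leaf a E : 0 < a -> measurable E ->
  (mu (alive a E `&` `[0%R, a[) + mu (alive a E `&` `[0%R, a[)
   <= mu E + mu (leaf a E `&` `[0%R, a[))%E.
Proof.
move=> a0 mE; have mL := measurable_leaf a mE; have mA := measurable_alive a mE.
rewrite (measure_fold a0 mE) -!integral_indic//.
rewrite -!ge0_integralD//; last 5 first.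
- by move=> x _; exact: degree_ge0.
- by apply: measurable_funTS; exact: measurable_degree.
- exact/measurable_EFinP/measurable_funTS.
- exact/measurable_EFinP/measurable_funTS.
- exact/measurable_EFinP/measurable_funTS.
apply: ge0_le_integral => //.
- by move=> x _; rewrite adde_ge0.
- by apply: emeasurable_funD; exact/measurable_EFinP/measurable_funTS.
- apply: emeasurable_funD; last exact/measurable_EFinP/measurable_funTS.
  by apply: measurable_funTS; exact: measurable_degree.
move=> x _; rewrite !indicE; case: fiberP => [_|k _|d k l _ _ _ d2] //=.
by rewrite adde0 -EFinD.
Qed.

End Leaves.

(** * Simultaneous removal of leaf edges and its measure accounting *)

Section LeafRemoval.
Context {R : realType}.
Local Notation mu := (@lebesgue_measure R).
Implicit Types (a b x t p q : R) (A E P N Om : set R) (u : R -> R).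

Definition weight u a E x : R := \sum_(k \in fiber a E x) u (x - k%:~R * a).

(** This form of the weights survives pruning. The coefficient of [p] is positive, so independence
    of [p] and [q] keeps the weights away from zero. *)
Definition weights_in u a E p q := forall x, alive a E x ->
  exists n m : nat, weight u a E x = p *+ n.+1 - q *+ m.

Definition prune a b E := E `\` (leaf a E `|` leaf b E).

Lemma pruneC a b E : prune a b E = prune b a E.
Proof. by rewrite /prune setUC. Qed.

Lemma fiber_sub a E E' x : E `<=` E' -> fiber a E x `<=` fiber a E' x.
Proof. by move=> EE' k; exact: EE'. Qed.

Lemma leaf_fiber a E x : E x -> leaf a E x -> fiber a E x = [set 0].
Proof.
move=> Ex [k xk]; rewrite xk.
suff : fiber a E x 0 by rewrite xk => ->.
by rewrite /fiber/= mul0r subr0.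
Qed.

Lemma weight_leaf u a E x : E x -> leaf a E x -> weight u a E x = u x.
Proof.
by move=> Ex Lx; rewrite /weight leaf_fiber// fsbig_set1 mul0r subr0.
Qed.

Lemma fsbig_closed (T : choiceType) (K : set T) (h : T -> R) (C : R -> Prop) :
  C 0 -> (forall x y, C x -> C y -> C (x + y)) -> finite_set K ->
  (forall k, K k -> C (h k)) -> C (\sum_(k \in K) h k).
Proof.
move=> C0 CD fK hK; rewrite fsbig_finite//= big_seq.
by apply: (big_ind C) => // k; rewrite in_fset_set// inE; exact: hK.
Qed.

Section OneSide.
Variables (u : R -> R) (a b p q : R) (E : set R).
Hypothesis fin : forall x, E x -> finite_set (fiber a E x).
Hypothesis wa : weights_in u a E p q.
Hypothesis wb : weights_in u b E q p.
Hypothesis indep : forall n m, p *+ n.+1 <> q *+ m.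

Lemma fin_fiber x : finite_set (fiber a E x).
Proof.
have [[k xk]|] := pselect (fiber a E x !=set0); last first.
  by move=> /set0P/negP/negPn/eqP ->.
exact: finite_fiber_shift (fin xk).
Qed.

(** At a vertex that is not a leaf, an edge can be removed only on account of its other end. *)
Lemma fiber_prune x : ~ leaf a E x ->
  fiber a (prune a b E) x =
  fiber a E x `&` ~` [set k | leaf b E (x - k%:~R * a)].
Proof.
move=> Lx; apply/seteqP; split=> [k [Ek /not_orP[]]//|k [Ek Lk]].
by split => // -[|//]; rewrite periodicE//; exact: periodic_leaf.
Qed.

(** The edges lost at [x] are leaf edges at their [b]-end, so the value of [u] on each is a
    [b]-weight [(n1+1) q - m1 p]. Subtracting these only raises the coefficients [n] and [m]. *)
Lemma weight_prune x : alive a E x -> ~ leaf a E x ->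
  exists n m : nat, weight u a (prune a b E) x = p *+ n.+1 - q *+ m.
Proof.
move=> Ax Lx; have [n [m xnm]] := wa Ax.
rewrite /weight fiber_prune//.
(* The coefficient of [q] may vanish here, so that [C] contains the empty sum. *)
pose C z := exists n m : nat, z = q *+ n - p *+ m.
have : C (\sum_(k \in fiber a E x `&` [set k | leaf b E (x - k%:~R * a)])
    u (x - k%:~R * a)).
  apply: fsbig_closed.
  - by exists 0%N, 0%N; rewrite !mulr0n subrr.
  - move=> _ _ [n1 [m1 ->]] [n2 [m2 ->]]; exists (n1 + n2)%N, (m1 + m2)%N.
    by rewrite !mulrnDr; ring.
  - exact/finite_setIl/fin_fiber.
  - move=> k [/= Ek Lk]; have [n1 [m1 h]] := wb (leaf_alive Lk).
    by exists n1.+1, m1; rewrite -h weight_leaf.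
move=> [n1 [m1 h]]; move: xnm.
rewrite /weight (fsbigID [set k | leaf b E (x - k%:~R * a)]); last exact: fin_fiber.
rewrite h => /(canRL (addKr _)) ->.
exists (n + m1)%N, (n1 + m)%N; rewrite -addSn !mulrnDr; ring.
Qed.

(** A leaf loses its only edge. Any other live vertex keeps one, since its new weight is nonzero
    while an empty fiber has weight zero. *)
Lemma alive_prune : alive a (prune a b E) = alive a E `\` leaf a E.
Proof.
apply/seteqP; split=> [x [k xk]|x [Ax Lx]].
  have [Ek /not_orP[]] := xk; rewrite periodicE; last exact: periodic_leaf.
  by split => //; exists k.
have [n [m h]] := weight_prune Ax Lx.
apply: contrapT => /set0P/negP/negPn/eqP xE; apply: (@indep n m).
by apply/eqP; rewrite -subr_eq0 -h /weight xE fsbig_set0.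
Qed.

Lemma weights_in_prune : weights_in u a (prune a b E) p q.
Proof. by move=> x; rewrite alive_prune => -[]; exact: weight_prune. Qed.

End OneSide.

Section Accounting.
Variables (u : R -> R) (a b p q : R).
Hypotheses (a0 : 0 < a) (b0 : 0 < b).
Hypothesis indep : forall n m, p *+ n = q *+ m -> n = 0%N /\ m = 0%N.

(** The invariant of pruning. Finite fibers make [weight] a genuine sum: by convention it is zero
    when infinitely many terms are nonzero. *)
Definition balanced E := [/\ measurable E,
  forall x, E x -> finite_set (fiber a E x),
  forall x, E x -> finite_set (fiber b E x),
  weights_in u a E p q & weights_in u b E q p].

Lemma balanced_prune E : balanced E -> balanced (prune a b E).
Proof.
move=> [mE fa fb wa wb]; split.
- apply: measurableD => //.
  by apply: measurableU; exact: measurable_leaf.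
- move=> x [Ex _]; apply: sub_finite_set (fa x Ex).
  by apply: fiber_sub; exact: subDsetl.
- move=> x [Ex _]; apply: sub_finite_set (fb x Ex).
  by apply: fiber_sub; exact: subDsetl.
- by apply: weights_in_prune => // n m /indep[].
- by rewrite pruneC; apply: weights_in_prune => // n m /esym/indep[].
Qed.

Definition vertices c E : \bar R := mu (alive c E `&` `[0, c[).
Definition leaves c E : \bar R := mu (leaf c E `&` `[0, c[).

Lemma vertices_prune E : balanced E ->
  vertices a E = (vertices a (prune a b E) + leaves a E)%E.
Proof.
move=> [mE fa fb wa wb]; rewrite /vertices (alive_prune fa wa wb);
  last by move=> n m /indep[].
have mA := measurable_alive a mE; have mL := measurable_leaf a mE.
rewrite /leaves -measureU//; last 3 first.
- by apply: measurableI => //; exact: measurableD.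
- exact: measurableI.
- by apply/seteqP; split=> // x [[[_ Lx] _] []].
congr mu; rewrite -setIUl setUC setDUK//; exact: leaf_alive.
Qed.

(* No edge is a leaf at both ends: its value would be both of the form
   [(n+1) p - m q] and of the form [(n'+1) q - m' p]. *)
Lemma measure_prune E : balanced E ->
  mu E = (mu (prune a b E) + (leaves a E + leaves b E))%E.
Proof.
move=> [mE fa fb wa wb].
have mLa := measurable_leaf a mE; have mLb := measurable_leaf b mE.
rewrite /leaves -!measure_leaf// -measureU//; last 3 first.
- exact: measurableI.
- exact: measurableI.
- apply/seteqP; split=> // x [[Ex La] [_ Lb]].
  have [n [m]] := wa _ (leaf_alive La); rewrite weight_leaf// => uE.
  have [n' [m']] := wb _ (leaf_alive Lb); rewrite weight_leaf// uE => h.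
  suff /indep[] : p *+ (n.+1 + m') = q *+ (n'.+1 + m) by [].
  rewrite !mulrnDr; lra.
rewrite -measureU//; last 3 first.
- by apply: measurableD => //; exact: measurableU.
- by apply: measurableU; exact: measurableI.
- by apply/seteqP; split=> // x [[Ex /not_orP[La Lb]] [[]|[]]].
by congr mu; rewrite -setIUr /prune setDE -setIUr setUC setUv setIT.
Qed.

End Accounting.

Lemma fin_itv_measure c A : 0 < c -> mu (A `&` `[0, c[) \is a fin_num.
Proof.
move=> c0; rewrite ge0_fin_numE//.
apply: (@le_lt_trans _ _ (mu `[0, c[)).
  by apply: le_outer_measure; exact: subIsetr.
by rewrite lebesgue_measure_itv/= lte_fin c0 sube0 ltry.
Qed.

(* The deficit [d] is preserved by [prune], and forces each pruning step to delete
   edge measure at least [2 d]. *)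
Lemma prune_bound u a b p q (d : R) n E : 0 < a -> 0 < b ->
  (forall n m, p *+ n = q *+ m -> n = 0%N /\ m = 0%N) ->
  0 < d -> balanced u a b p q E ->
  (mu E + d%:E = vertices a E + vertices b E)%E ->
  ((d *+ n *+ 2)%:E <= mu E)%E.
Proof.
move=> a0 b0 indep d0; elim: n E => [|n IH] E bE Ed.
  by rewrite !mul0rn measure_ge0.
have indep' n' m' : q *+ n' = p *+ m' -> n' = 0%N /\ m' = 0%N.
  by move=> /esym/indep[].
have bE' : balanced u b a q p E by case: bE.
have IHE := IH _ (balanced_prune indep bE).
have eE := measure_prune a0 b0 indep bE.
have va := vertices_prune indep bE.
have := vertices_prune indep' bE'; rewrite pruneC => vb.
have [mE _ _ _ _] := bE.
have la := le_alive_leaf a0 mE; have lb := le_alive_leaf b0 mE.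
rewrite -!/(vertices _ _) -!/(leaves _ _) in la lb.
have fva := fin_itv_measure (alive a E) a0.
have fvb := fin_itv_measure (alive b E) b0.
have fva' := fin_itv_measure (alive a (prune a b E)) a0.
have fvb' := fin_itv_measure (alive b (prune a b E)) b0.
have fla := fin_itv_measure (leaf a E) a0.
have flb := fin_itv_measure (leaf b E) b0.
rewrite -!/(vertices _ _) -!/(leaves _ _) in fva fvb fva' fvb' fla flb.
have fE : mu E \is a fin_num.
  have : mu E + d%:E \is a fin_num by rewrite Ed fin_numD fva.
  by rewrite fin_numD => /andP[].
have fE' : mu (prune a b E) \is a fin_num.
  by move: fE; rewrite eE fin_numD => /andP[].
move: Ed IHE eE va vb la lb.
rewrite -(fineK fva) -(fineK fvb) -(fineK fva') -(fineK fvb').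
rewrite -(fineK fla) -(fineK flb) -(fineK fE) -(fineK fE').
rewrite -!EFinD !lee_fin => -[Ed] IHE [eE] [va] [vb] la lb.
(* Edges and vertices lose the same measure, so the pruned set has the same deficit [d]. *)
have {}IHE : d *+ n *+ 2 <= fine (mu (prune a b E)).
  by apply: IHE; congr EFin; lra.
(* Adding [la] and [lb] and inserting the deficit shows that the leaves have measure at least
   [2 d]. *)
by move: IHE; rewrite [d *+ n.+1]mulrSr !mulr2n; lra.
Qed.

(** Otherwise [mu E] is finite with a positive deficit [d], and [prune_bound] fails once [n d]
    exceeds [mu E]. *)
Lemma le_measure_balanced u a b p q E : 0 < a -> 0 < b ->
  (forall n m, p *+ n = q *+ m -> n = 0%N /\ m = 0%N) ->
  balanced u a b p q E -> (vertices a E + vertices b E <= mu E)%E.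
Proof.
move=> a0 b0 indep bE; rewrite leNgt; apply/negP => Elt.
have fa := fin_itv_measure (alive a E) a0.
have fb := fin_itv_measure (alive b E) b0.
rewrite -!/(vertices _ _) in fa fb.
have fE : mu E \is a fin_num.
  by rewrite ge0_fin_numE// (lt_trans Elt)// ltey_eq fin_numD fa fb.
pose d := fine (vertices a E) + fine (vertices b E) - fine (mu E).
have d0 : 0 < d by rewrite subr_gt0 -lte_fin EFinD !fineK.
have Ed : (mu E + d%:E = vertices a E + vertices b E)%E.
  by rewrite -(fineK fE) -(fineK fa) -(fineK fb) -!EFinD addrC subrK.
have := prune_bound (Num.truncn (fine (mu E) / d)).+1 a0 b0 indep d0 bE Ed.
rewrite leNgt => /negP; apply; rewrite -[X in (X < _)%E](fineK fE) lte_fin.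
have h : fine (mu E) < d *+ (Num.truncn (fine (mu E) / d)).+1.
  by rewrite -mulr_natl -ltr_pdivrMr// truncnS_gt.
have e0 : 0 <= fine (mu E) by exact: fine_ge0.
by rewrite mulr2n; lra.
Qed.

End LeafRemoval.

(** * The lower bound for the support of a real Borel function *)

Section SupportBound.
Context {R : realType}.
Local Notation mu := (@lebesgue_measure R).
Implicit Types (a b x t p q s : R) (A E P N Om : set R) (u : R -> R).
Local Open Scope fset_scope.

Definition net_sum (v : int -> R) s := forall e, 0 < e ->
  exists A : {fset int}, forall B : {fset int}, A `<=` B ->
    `|\sum_(i <- B) v i - s| < e.

(** Partial sums over finite sets containing the support of [v] all equal the full sum. *)
Lemma net_sum_finite (v : int -> R) s : net_sum v s ->
  finite_set [set k | v k != 0] -> \sum_(k \in [set: int]) v k = s.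
Proof.
move=> vs fv; apply/eqP; rewrite -subr_eq0; apply/negPn/negP => vs0.
have [A /(_ (A `|` fset_set [set k | v k != 0]) (fsubsetUl _ _))] :=
  vs `|\sum_(k \in [set: int]) v k - s| (ltac:(by rewrite normr_gt0)).
suff -> : \sum_(i <- A `|` fset_set [set k | v k != 0]) v i =
  \sum_(k \in [set: int]) v k by rewrite ltxx.
apply/esym/fsbigTE => k; apply: contraNeq => vk.
by rewrite in_fsetU orbC in_fset_set// mem_set.
Qed.

Local Close Scope fset_scope.

Definition tiles_at u a p x :=
  summable [set: int] (fun k => (u (x - k%:~R * a))%:E) /\
  net_sum (fun k => u (x - k%:~R * a)) p.

Definition ssupp u : set R := [set x | u x != 0].

Lemma measurable_ssupp u : measurable_fun setT u -> measurable (ssupp u).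
Proof.
move=> mu_; rewrite (_ : ssupp u = setT `&` u @^-1` (~` [set 0])).
  by apply: mu_ => //; exact: measurableC.
by rewrite setTI; apply/seteqP; split=> x /= /eqP.
Qed.

(** The degree has integral [mu E] over a period, hence is finite almost everywhere there. *)
Lemma ae_finite_fiber a E : 0 < a -> measurable E -> (mu E < +oo)%E ->
  exists N, [/\ measurable N, mu N = 0%E &
    forall x, ~ N x -> `[0, a[%classic x -> finite_set (fiber a E x)].
Proof.
move=> a0 mE Eoo.
have : mu.-integrable `[0, a[ (degree a E).
  apply/integrableP; split.
    by apply: measurable_funTS; exact: measurable_degree.
  under eq_integral do rewrite gee0_abs ?degree_ge0//.
  by rewrite -measure_fold.
move=> /integrable_ae => /(_ (measurable_itv _))[N [mN N0 NE]].
exists N; split => // x Nx Ix; apply: degree_fin.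
have : `[0, a[%classic x -> degree a E x \is a fin_num.
  by apply: contrapT => h; apply: Nx; apply: NE.
by move=> /(_ Ix); rewrite fin_num_abs gee0_abs// degree_ge0.
Qed.

Lemma measure_conull_itv a Om : 0 < a -> measurable Om -> mu (~` Om) = 0%E ->
  mu (Om `&` `[0, a[) = a%:E.
Proof.
move=> a0 mOm Om0.
have mD : measurable (`[0, a[ `\` Om) by exact: measurableD.
rewrite -(@measureU0 _ _ _ mu _ (`[0, a[ `\` Om))//; last first.
  apply/eqP; rewrite -measure_le0 -Om0; apply: le_measure; rewrite ?inE//.
    exact: measurableC.
  exact: measurableI.
rewrite setIC setUIDK -[LHS]/(mu `[0, a[).
by rewrite lebesgue_measure_itv/= lte_fin a0 sube0.
Qed.

Lemma le_support u a b p q N : 0 < a -> 0 < b ->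
  (forall n m : nat, p *+ n = q *+ m -> n = 0%N /\ m = 0%N) ->
  measurable_fun setT u -> measurable N -> mu N = 0%E ->
  (forall x, ~ N x -> tiles_at u a p x /\ tiles_at u b q x) ->
  ((a + b)%:E <= mu (ssupp u))%E.
Proof.
move=> a0 b0 indep mfu mN N0 tile.
have mS := measurable_ssupp mfu.
have [->|] := eqVneq (mu (ssupp u)) +oo%E; first by rewrite leey.
rewrite -ltey => Soo.
have [Na [mNa Na0 finNa]] := ae_finite_fiber a0 mS Soo.
have [Nb [mNb Nb0 finNb]] := ae_finite_fiber b0 mS Soo.
pose M := N `|` (Na `|` Nb).
have mM : measurable M by apply: measurableU => //; exact: measurableU.
have M0 : mu M = 0%E.
  have h A B : measurable A -> measurable B -> mu A = 0%E -> mu B = 0%E ->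
      mu (A `|` B) = 0%E.
    by move=> mA mB A0 B0; rewrite measureU0.
  by apply: (h) => //; [exact: measurableU|exact: h].
have [Om [mOm Om0 aOm bOm OmM]] := conull_invariant a b mM M0.
(* The initial edge set: the support cut down to an invariant conull set where tiling holds and
   fibers are finite. *)
pose E := ssupp u `&` Om.
have fa x : Om x -> finite_set (fiber a (ssupp u) x).
  move=> Ox; apply: (@finite_fiber_shift _ a _ x (Num.floor (x / a))).
  apply: finNa; last exact: sub_floor_itv.
  by move=> h; apply: (OmM _ (aOm _ (Num.floor (x / a)) Ox)); right; left.
have fb x : Om x -> finite_set (fiber b (ssupp u) x).
  move=> Ox; apply: (@finite_fiber_shift _ b _ x (Num.floor (x / b))).
  apply: finNb; last exact: sub_floor_itv.
  by move=> h; apply: (OmM _ (bOm _ (Num.floor (x / b)) Ox)); right; right.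
have wE c r x : periodic c Om -> Om x -> tiles_at u c r x ->
    finite_set (fiber c (ssupp u) x) -> weight u c E x = r.
  move=> cOm Ox [_ ur] fx; rewrite -(net_sum_finite ur)//.
  apply: fsbig_widen => // k [_] /=; apply: contra_notP => /eqP uk.
  by split => //; exact: cOm.
have tiles x : Om x -> tiles_at u a p x /\ tiles_at u b q x.
  by move=> Ox; apply: tile => Nx; apply: (OmM _ Ox); left.
have aliveO c : periodic c Om -> alive c E `<=` Om.
  by move=> cOm x [k [_]]; rewrite periodicE.
have bE : balanced u a b p q E.
  split.
  - exact: measurableI.
  - move=> x [_ Ox]; apply: sub_finite_set (fa _ Ox).
    by apply: fiber_sub; exact: subIsetl.
  - move=> x [_ Ox]; apply: sub_finite_set (fb _ Ox).
    by apply: fiber_sub; exact: subIsetl.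
  (* Before any pruning the weights are exactly [p] and, on the other side, [q]. *)
  - move=> x /(aliveO _ aOm) Ox; exists 0%N, 0%N.
    by rewrite subr0; apply: wE => //; [case: (tiles _ Ox)|exact: fa].
  - move=> x /(aliveO _ bOm) Ox; exists 0%N, 0%N.
    by rewrite subr0; apply: wE => //; [case: (tiles _ Ox)|exact: fb].
(* A nonzero level forces an edge at every vertex of [Om], so the vertices have total measure
   [a + b]. *)
have aliveE c r : r != 0 -> periodic c Om ->
    (forall x, Om x -> weight u c E x = r) -> alive c E = Om.
  move=> r0 cOm wr; apply/seteqP; split; first exact: aliveO.
  move=> x Ox; apply: contrapT => /set0P/negP/negPn/eqP xE.
  by move: r0; rewrite -(wr _ Ox) /weight xE fsbig_set0 eqxx.
have p0 : p != 0.
  by apply/eqP => p0; have [] // := indep 1%N 0%N; rewrite p0 mul0rn.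
have q0 : q != 0.
  by apply/eqP => q0; have [] // := indep 0%N 1%N; rewrite q0 mul0rn.
have va : vertices a E = a%:E.
  rewrite /vertices (aliveE _ _ p0 aOm) ?measure_conull_itv// => x Ox.
  by apply: wE => //; [case: (tiles _ Ox)|exact: fa].
have vb : vertices b E = b%:E.
  rewrite /vertices (aliveE _ _ q0 bOm) ?measure_conull_itv// => x Ox.
  by apply: wE => //; [case: (tiles _ Ox)|exact: fb].
have := le_measure_balanced a0 b0 indep bE; rewrite va vb => /le_trans; apply.
by apply: le_outer_measure; exact: subIsetl.
Qed.

End SupportBound.

(** * The relation between the levels for nonnegative or integrable functions *)

Section Levels.
Context {R : realType}.
Local Notation mu := (@lebesgue_measure R).
Implicit Types (a b x t p q s : R) (A E P N Om : set R) (u : R -> R).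

Lemma maxrB0 (y : R) : Num.max y 0 - Num.max (- y) 0 = y.
Proof. by rewrite /Num.max; case: ltP => ?; case: ltP => ?; lra. Qed.

Lemma net_sum_unique (v : int -> R) s s' : net_sum v s -> net_sum v s' -> s = s'.
Proof.
move=> vs vs'; apply/eqP; rewrite -subr_eq0; apply/negPn/negP => ss'.
have e0 : 0 < `|s - s'| / 2 by rewrite divr_gt0// normr_gt0.
have [A hA] := vs _ e0; have [B hB] := vs' _ e0.
have := hA _ (fsubsetUl A B); have := hB _ (fsubsetUr A B).
set S := (\sum_(i <- _) _) => h1 h2.
have : `|s - s'| <= `|S - s'| + `|S - s|.
  have -> : s - s' = (S - s') - (S - s) by ring.
  exact: ler_normB.
lra.
Qed.

Lemma net_sumB (v w : int -> R) s s' : net_sum v s -> net_sum w s' ->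
  net_sum (v \- w) (s - s').
Proof.
move=> vs ws' e e0; have e20 : 0 < e / 2 by rewrite divr_gt0.
have [A hA] := vs _ e20; have [B hB] := ws' _ e20.
exists (fsetU A B) => C; rewrite fsubUset => /andP[/hA h1 /hB h2].
have -> : \sum_(i <- C) (v \- w) i - (s - s') =
    (\sum_(i <- C) v i - s) - (\sum_(i <- C) w i - s').
  by rewrite sumrB; ring.
apply: le_lt_trans (ler_normB _ _) _; lra.
Qed.

(** Take a finite set nearly attaining the supremum; sums over larger finite sets stay between its
    sum and [s]. *)
Lemma net_sum_ge0 (w : int -> R) s : (forall k, 0 <= w k) ->
  (\esum_(k in [set: int]) (w k)%:E = s%:E)%E -> net_sum w s.
Proof.
move=> w0 ws e e0.
have fs : (\esum_(k in [set: int]) (w k)%:E)%E \is a fin_num by rewrite ws.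
have [_ [X [fX _] <-]] := ub_ereal_sup_adherent e0 fs.
rewrite -/(esum _ _) ws fsbig_finite//= sumEFin -EFinB lte_fin => sX.
exists (fset_set X) => B XB.
have le1 : \sum_(i <- fset_set X) w i <= \sum_(i <- B) w i.
  pose w' i := if i \in fset_set X then w i else 0.
  rewrite (eq_big_seq w') => [|i Xi]; last by rewrite /w' Xi.
  rewrite (big_fset_incl _ XB) => [|i _ /negbTE Xi]; last by rewrite /w' Xi.
  by apply: ler_sum => i _; rewrite /w'; case: ifP.
have le2 : \sum_(i <- B) w i <= s.
  rewrite -lee_fin -ws -sumEFin; apply: esum_ge; exists [set` B].
    by split => //; exact: finite_fset.
  by rewrite fsbig_finite//= set_fsetK.
by rewrite ler0_norm ?subr_le0// opprB; lra.
Qed.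

Lemma net_sum_esum (v : int -> R) s :
  summable [set: int] (fun k => (v k)%:E) -> net_sum v s ->
  (\esum_(k in [set: int]) (Num.max (v k) 0)%:E =
   \esum_(k in [set: int]) (Num.max (- v k) 0)%:E + s%:E)%E.
Proof.
move=> sv vs.
have fin (w : int -> R) : (forall k, 0 <= w k <= `|v k|) ->
    (\esum_(k in [set: int]) (w k)%:E)%E \is a fin_num.
  move=> wv; rewrite ge0_fin_numE; last first.
    by apply: esum_ge0 => k _; rewrite lee_fin; case/andP: (wv k).
  apply: le_lt_trans sv; apply: le_esum => k _.
  by rewrite lee_fin; case/andP: (wv k).
have fp : (\esum_(k in [set: int]) (Num.max (v k) 0)%:E)%E \is a fin_num.
  apply: fin => k; rewrite le_max lexx orbT/= ge_max normr_ge0 andbT.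
  exact: ler_norm.
have fn : (\esum_(k in [set: int]) (Num.max (- v k) 0)%:E)%E \is a fin_num.
  apply: fin => k; rewrite le_max lexx orbT/= ge_max normr_ge0 andbT.
  by rewrite -normrN; exact: ler_norm.
have hp := @net_sum_ge0 (fun k => Num.max (v k) 0) _
  (fun k => ltac:(by rewrite le_max lexx orbT)) (esym (fineK fp)).
have hn := @net_sum_ge0 (fun k => Num.max (- v k) 0) _
  (fun k => ltac:(by rewrite le_max lexx orbT)) (esym (fineK fn)).
have := net_sumB hp hn.
rewrite (_ : _ \- _ = v); last first.
  by apply/funext => k /=; exact: maxrB0.
move=> /(net_sum_unique vs) ->.
by rewrite EFinB !fineK// addrC subeK.
Qed.

(** This is the identity [\int u = p a] with negative parts moved across, so that it makes sense
    even if both integrals are infinite. *)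
Lemma tile_integral_posneg u a p N : 0 < a ->
  measurable_fun setT u -> measurable N -> mu N = 0%E ->
  (forall x, ~ N x -> tiles_at u a p x) ->
  (\int[mu]_x (Num.max (u x) 0)%:E + (Num.max (- p) 0 * a)%:E =
   \int[mu]_x (Num.max (- u x) 0)%:E + (Num.max p 0 * a)%:E)%E.
Proof.
move=> a0 mfu mN N0 tile.
have mp : measurable_fun setT (fun x => (Num.max (u x) 0)%:E).
  by apply/measurable_EFinP/measurable_funrpos.
have mn : measurable_fun setT (fun x => (Num.max (- u x) 0)%:E).
  by apply/measurable_EFinP/measurable_funrneg.
have max0 (y : R) : (0 <= (Num.max y 0)%:E)%E by rewrite lee_fin le_max lexx orbT.
rewrite (integral_fold a0 mp)// (integral_fold a0 mn)//.
have muI : mu `[0, a[ = a%:E by rewrite lebesgue_measure_itv/= lte_fin a0 sube0.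
have itv_cst (r : R) : (r * a)%:E = (\int[mu]_(x in `[0%R, a[) r%:E)%E.
  by rewrite integral_cst// EFinM -muI.
rewrite !itv_cst -!ge0_integralD//; last 4 first.
- by move=> x _; apply: esum_ge0.
- by apply: measurable_funTS; exact: (measurable_fold a mn).
- by move=> x _; apply: esum_ge0.
- by apply: measurable_funTS; exact: (measurable_fold a mp).
apply: ge0_ae_eq_integral => //.
- apply: emeasurable_funD => //.
  by apply: measurable_funTS; exact: (measurable_fold a mp).
- apply: emeasurable_funD => //.
  by apply: measurable_funTS; exact: (measurable_fold a mn).
- by move=> x _; rewrite adde_ge0// esum_ge0.
- by move=> x _; rewrite adde_ge0// esum_ge0.
exists N; split => // x; apply: contra_notP => Nx Ix.
have [sx nx] := tile _ Nx; rewrite (net_sum_esum sx nx) -addeA -EFinD.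
by congr (_ + _%:E)%E; have := maxrB0 p; lra.
Qed.

Lemma tile_levels_integral u a b p q N : 0 < a -> 0 < b ->
  measurable_fun setT u -> measurable N -> mu N = 0%E ->
  (forall x, ~ N x -> tiles_at u a p x /\ tiles_at u b q x) ->
  (forall x, 0 <= u x) \/ mu.-integrable setT (EFin \o u) ->
  p * a = q * b.
Proof.
move=> a0 b0 mfu mN N0 tile uH.
have := @tile_integral_posneg u a p N a0 mfu mN N0 (fun x Nx => (tile x Nx).1).
have := @tile_integral_posneg u b q N b0 mfu mN N0 (fun x Nx => (tile x Nx).2).
set Ip := integral _ _ _; set In := integral _ _ _ => hb ha.
have max0 (y : R) : (0 <= (Num.max y 0)%:E)%E by rewrite lee_fin le_max lexx orbT.
have Ip0 : (0 <= Ip)%E by apply: integral_ge0.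
have In0 : (0 <= In)%E by apply: integral_ge0.
(* Finiteness allows cancellation. For nonnegative [u], [In] is zero and [ha] then makes [Ip]
   finite. *)
have [fp fn] : Ip \is a fin_num /\ In \is a fin_num.
  case: uH => [u0|iu].
    have In0' : In = 0%E.
      by apply: integral0_eq => x _; rewrite max_r// oppr_le0.
    split; last by rewrite In0'.
    move: ha; rewrite In0' add0e => h.
    have : (Ip + (Num.max (- p) 0 * a)%:E)%E \is a fin_num by rewrite h.
    by rewrite fin_numD => /andP[].
  split; rewrite ge0_fin_numE//; case/integrableP: iu => _; apply: le_lt_trans.
    apply: ge0_le_integral => //.
    - by apply/measurable_EFinP/measurable_funrpos.
    - by apply/measurableT_comp => //; exact/measurable_EFinP.
    - by move=> x _; rewrite lee_fin ge_max ler_norm normr_ge0.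
  apply: ge0_le_integral => //.
  - by apply/measurable_EFinP/measurable_funrneg.
  - by apply/measurableT_comp => //; exact/measurable_EFinP.
  - by move=> x _; rewrite lee_fin ge_max -normrN ler_norm normr_ge0.
move: ha hb; rewrite -(fineK fp) -(fineK fn) -!EFinD => -[ha] [hb].
by rewrite -[in LHS](maxrB0 p) -[in RHS](maxrB0 q) !mulrBl; lra.
Qed.

End Levels.

(** * Periodizations of functions of bounded support *)

Section CompactSums.
Context {R : realType}.
Local Notation mu := (@lebesgue_measure R).
Implicit Types (a b c x y t p q s M : R) (A E P N Om : set R) (h g u : R -> R).

Definition translate_sum c h x : R := \sum_(k \in [set: int]) h (x - k%:~R * c).

(** The translates are indexed by the integers from [-K] to [K]. *)
Definition symm_sum c h (K : nat) x : R :=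
  \sum_(0 <= i < K.*2.+1) h (x - (i%:Z - K%:Z)%:~R * c).

Definition vanishes_beyond M h := forall x, M < `|x| -> h x = 0.

Lemma vanishesW M M' h : M <= M' -> vanishes_beyond M h -> vanishes_beyond M' h.
Proof. by move=> MM' hM x xM; apply: hM; exact: le_lt_trans xM. Qed.

Definition symm_range (K : nat) : seq int :=
  [seq i%:Z - K%:Z | i <- index_iota 0 K.*2.+1].

Lemma symm_range_uniq K : uniq (symm_range K).
Proof. by rewrite map_inj_uniq ?iota_uniq// => i j /addIr []. Qed.

Lemma mem_symm_range c M h (K : nat) x (k : int) : 0 < c -> vanishes_beyond M h ->
  `|x| + M <= K%:R * c -> h (x - k%:~R * c) != 0 -> k \in symm_range K.
Proof.
move=> c0 hM xK hk.
have xM : `|x - k%:~R * c| <= M.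
  by rewrite leNgt; apply: contraNN hk => /hM ->.
have kK : `|k%:~R| <= K%:R :> R.
  rewrite -(ler_pM2r c0) (le_trans _ xK)// -{1}(gtr0_norm c0) -normrM.
  have -> : k%:~R * c = x - (x - k%:~R * c) by ring.
  by rewrite (le_trans (ler_normB _ _))// lerD2l.
have {}kK : (`|k| <= K)%N.
  by move: kK; rewrite -intr_norm pmulrn ler_int -abszE lez_nat.
by apply/mapP; exists (absz (k + K%:Z)); [rewrite mem_index_iota|]; lia.
Qed.

Lemma symm_sumE c M h K x : 0 < c -> vanishes_beyond M h ->
  `|x| + M <= K%:R * c -> translate_sum c h x = symm_sum c h K x.
Proof.
move=> c0 hM xK.
rewrite /symm_sum -(big_map (fun i : nat => i%:Z - K%:Z) xpredT
  (fun k => h (x - k%:~R * c))) fsbig_seq ?symm_range_uniq//.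
apply/esym/fsbig_widen => // k [_ /= kr]; apply/eqP; apply: contra_notT kr.
exact: (mem_symm_range c0 hM xK).
Qed.

Lemma large_nat c y : 0 < c -> exists K0 : nat, forall K, (K0 <= K)%N -> y <= K%:R * c.
Proof.
move=> c0; exists (Num.truncn (y / c)).+1 => K hK.
rewrite -ler_pdivrMr// (le_trans (ltW (truncnS_gt _)))//.
by rewrite ler_nat.
Qed.

Lemma translate_sum_finite c M h x : 0 < c -> vanishes_beyond M h ->
  finite_set [set k : int | h (x - k%:~R * c) != 0].
Proof.
move=> c0 hM; have [K0 /(_ _ (leqnn _)) hK] := large_nat (`|x| + M) c0.
apply: (@sub_finite_set _ _ [set` symm_range K0]); last exact: finite_seq.
by move=> k /=; exact: (mem_symm_range c0 hM hK).
Qed.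

Lemma translate_sum_shift c h x (l : int) :
  translate_sum c h (x - l%:~R * c) = translate_sum c h x.
Proof.
rewrite /translate_sum [RHS](reindex_fsbigT (fun k => k + l)); last first.
  by exists (fun k => k - l) => k; rewrite ?addrK ?subrK.
by apply: eq_fsbigr => k _; congr h; rewrite intrD; ring.
Qed.

Lemma translate_sumB c M h g x : 0 < c -> vanishes_beyond M h ->
  vanishes_beyond M g ->
  translate_sum c (h \- g) x = translate_sum c h x - translate_sum c g x.
Proof.
move=> c0 hM gM; have [K0 /(_ _ (leqnn _)) hK] := large_nat (`|x| + M) c0.
rewrite !(symm_sumE c0 _ hK)// /symm_sum ?sumrB//.
by move=> y yM /=; rewrite hM// gM// subr0.
Qed.

(** The sum telescopes to the far right value [L] of [w] minus its far left value 0. *)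
Lemma translate_sum_telescope c M (w : R -> R) L x : 0 < c -> 0 <= M ->
  (forall y, y < - M -> w y = 0) -> (forall y, M < y -> w y = L) ->
  translate_sum c (fun y => w y - w (y - c)) x = L.
Proof.
move=> c0 M0 s0 sL.
have sM : vanishes_beyond (M + c) (fun y => w y - w (y - c)).
  move=> y; rewrite lter_normr => /orP[] yM.
    by rewrite !sL ?subrr//; lra.
  by rewrite !s0 ?subrr//; lra.
have [K0 /(_ _ (leqnn _)) hK] := large_nat (`|x| + (M + c) + 1) c0.
rewrite (symm_sumE (K := K0) c0 sM); last by rewrite (le_trans _ hK)// lerDl.
rewrite /symm_sum.
(* The minus sign is there because the argument of [w] moves left as [i] grows. *)
pose f (i : nat) := - w (x - (i%:Z - K0%:Z)%:~R * c).
rewrite (eq_bigr (fun i => f i.+1 - f i)); last first.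
  move=> i _; rewrite /f opprK [RHS]addrC; congr (_ - w _).
  by rewrite -addn1 PoszD !intrD; ring.
have xx := ler_norm x; have xx' := ler_norm (- x); rewrite normrN in xx'.
rewrite telescope_sumr// /f opprK.
have -> : (K0.*2.+1%:Z - K0%:Z) = K0.+1%:Z by lia.
rewrite sub0r -!pmulrn mulrNz -pmulrn.
rewrite s0; last by rewrite mulrSr; lra.
by rewrite sL ?oppr0 ?add0r//; lra.
Qed.

Lemma measurable_translate_sum c M h : 0 < c -> vanishes_beyond M h ->
  measurable_fun setT h -> measurable_fun setT (translate_sum c h).
Proof.
move=> c0 hM mh.
apply: (@measurable_fun_cvg _ _ _ _ (fun K => symm_sum c h K)).
  move=> K; apply: measurable_sum => i.
  by apply: (measurableT_comp mh); exact: measurable_shift.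
move=> x _; apply: cvg_near_cst.
have [K0 hK] := large_nat (`|x| + M) c0.
by exists K0 => // K /= /hK /(symm_sumE c0 hM) ->.
Qed.

End CompactSums.

(** * Drift along a rotation, and the trapezoid *)

Section BoundedLevels.
Context {R : realType}.
Local Notation mu := (@lebesgue_measure R).
Implicit Types (a b c x y t p q r M : R) (A E P N Om : set R) (h g u G : R -> R).

(** Translation by [a] permutes the sets [A n] cyclically modulo [b]-periods, so [b] would be a sum
    of infinitely many equal terms, which is zero or infinite. *)
Lemma no_drift G a b r Om : 0 < b -> measurable_fun setT G ->
  measurable Om -> mu (~` Om) = 0%E -> periodic a Om -> periodic b Om ->
  (forall x (k : int), G (x - k%:~R * b) = G x) ->
  (forall x, Om x -> G (x - a) = G x - r) -> r = 0.
Proof.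
move=> b0 mG mOm Om0 aOm bOm Gb Ga; apply/eqP/negPn/negP => r0.
pose A (n : int) : set R := Om `&` [set x | Num.floor (G x / r) = n].
have mA n : measurable (A n).
  rewrite (_ : A n = Om `&` (setT `&` (fun x => G x / r) @^-1` `[n%:~R, (n + 1)%:~R[)).
    apply: measurableI => //.
    by apply: measurable_funM => //; exact: measurable_itv.
  rewrite setTI; apply/seteqP; split => x [Ox] /=; rewrite in_itv/=.
    by move=> <-; split => //; exact: floor_itv.
  by move=> h; split => //; exact: floor_def.
have bA n : periodic b (A n).
  by move=> x k [Ox /= xn]; split; [exact: bOm|rewrite /= Gb].
have floorB1 (z : R) : Num.floor (z - 1) = Num.floor z - 1.
  by rewrite floorDrz ?rpredN ?rpred1// floorN ?rpred1// floor1.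
(* Since [G (x - a) / r = G x / r - 1] on [Om], the point [x - a] lies in [A n] exactly when [x]
   lies in [A (n + 1)]. *)
have AS n : mu (A (n + 1) `&` `[0, b[) = mu (A n `&` `[0, b[).
  rewrite -(periodic_measure_shift (- a) b0 (mA n) (bA n)); congr (mu (_ `&` _)).
  have Oma x : Om (x - a) <-> Om x.
    by rewrite -[a in x - a]mul1r -[1]/(1%:~R) periodicE.
  apply/seteqP; split=> x [Ox /= xn].
    split; first exact/Oma.
    by rewrite /= Ga// mulrBl divff// floorB1 xn addrK.
  have {}Ox : Om x by exact/Oma.
  split => //=; move: xn; rewrite Ga// mulrBl divff// floorB1 => <-.
  by rewrite subrK.
have AE n : mu (A n `&` `[0, b[) = mu (A 0 `&` `[0, b[).
  elim/int_ind: n => // n IH; first by rewrite -addn1 PoszD AS.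
  by rewrite -IH -AS; congr (mu (A _ `&` _)); lia.
have ItvE : `[0, b[ `&` Om = \bigcup_n (A (int_enum n) `&` `[0, b[).
  apply/seteqP; split=> [x [Ix Ox]|x [n _ [[Ox _] Ix]]//].
  have [_ _ /(_ (Num.floor (G x / r)) I)[n _ nE]] := int_enum_bij.
  by exists n.
have sumE : (b%:E = \sum_(n <oo) mu (A 0%R `&` `[0%R, b[))%E.
  have mAI n : measurable (A (int_enum n) `&` `[0, b[).
    by apply: measurableI; [exact: mA|exact: measurable_itv].
  rewrite -(measure_conull_itv b0 mOm Om0) setIC ItvE measure_semi_bigcup//=.
  - by apply: eq_eseriesr => n _; rewrite AE.
  - move=> m n _ _ [x [[[_ /= xm] _] [[_ /= xn] _]]].
    have [_ inj _] := int_enum_bij.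
    by apply: inj; rewrite ?inE// -xm -xn.
  - exact: bigcupT_measurable.
have fA := fin_itv_measure (A 0) b0.
set c := mu _ in sumE fA.
have c0 : (0 <= c)%E by exact: measure_ge0.
have cb K : fine c *+ K <= b.
  rewrite -lee_fin sumE -[K]subn0 -sumr_const_nat -sumEFin.
  under eq_bigr do rewrite fineK//.
  exact: nneseries_lim_ge.
have [c00|cpos] := eqVneq c 0%E.
  by move: sumE b0; rewrite c00 eseries0// => -[->]; rewrite ltxx.
have fc0 : 0 < fine c by rewrite fine_gt0// lt0e cpos c0 -ge0_fin_numE.
have := cb (Num.truncn (b / fine c)).+1.
rewrite leNgt => /negP; apply.
by rewrite -mulr_natl -ltr_pdivrMr// truncnS_gt.
Qed.

Definition clip c x : R := Num.min (Num.max x 0) c.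

Lemma clipE c x : 0 < c ->
  clip c x = if x < 0 then 0 else if x < c then x else c.
Proof.
move=> c0; rewrite /clip; have [x0|x0] := ltP x 0.
  by rewrite min_l// ltW.
by rewrite /Num.min; case: ltP.
Qed.

Lemma clip_lt0 c x : 0 < c -> x < 0 -> clip c x = 0.
Proof. by move=> c0 x0; rewrite /clip max_r ?ltW// min_l// ltW. Qed.

Lemma clip_gt c x : 0 < c -> c < x -> clip c x = c.
Proof.
by move=> c0 cx; rewrite /clip max_l ?(ltW (lt_trans c0 cx))// min_r// ltW.
Qed.

Lemma measurable_clip c : measurable_fun setT (clip c).
Proof.
apply: measurable_minr => //; exact: (measurable_maxr (f := fun x : R => x)).
Qed.

(** This is the convolution of the indicators of [[0, a[] and [[0, b[], whence its symmetry in [a]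
    and [b]. *)
Definition trapezoid a b x := clip b x - clip b (x - a).

Lemma trapezoidC a b x : 0 < a -> 0 < b -> trapezoid a b x = trapezoid b a x.
Proof.
move=> a0 b0; rewrite /trapezoid !clipE//.
by do ?[case: ltP => ?]; lra.
Qed.

Lemma trapezoid_sum a b x : 0 < a -> 0 < b ->
  translate_sum a (trapezoid a b) x = b.
Proof.
move=> a0 b0; apply: (@translate_sum_telescope _ a b) => //; first exact: ltW.
  by move=> y yb; apply: clip_lt0 => //; lra.
by move=> y yb; exact: clip_gt.
Qed.

Lemma trapezoid_vanishes a b : 0 < a -> 0 < b ->
  vanishes_beyond (a + b) (trapezoid a b).
Proof.
move=> a0 b0 x; rewrite lter_normr => /orP[] xab; rewrite /trapezoid.
  by rewrite !clip_gt ?subrr//; lra.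
by rewrite !clip_lt0 ?subrr//; lra.
Qed.

End BoundedLevels.

(** * The relation between the levels for bounded support *)

Section BoundedTiling.
Context {R : realType}.
Local Notation mu := (@lebesgue_measure R).
Implicit Types (a b c x y t p q r M : R) (A E P N Om : set R) (h g u G : R -> R).

(* [g] is the sum of [v (. - j a)] over all [j >= 0], cut off beyond [M], where
   it vanishes because the full sum over the integers does. *)
Lemma potential a v M : 0 < a -> 0 <= M ->
  vanishes_beyond M v -> measurable_fun setT v ->
  exists g, [/\ vanishes_beyond M g, measurable_fun setT g &
    forall y, translate_sum a v (y - a) = 0 -> g y - g (y - a) = v y].
Proof.
(* With [J a] above [2 M], shifting a point [y <= M] by [J a] lands below [-M], where [v]
   vanishes. *)
move=> a0 M0 vM mv; have [J /(_ _ (leqnn _)) hJ] := large_nat (2 * M + 1) a0.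
pose P y := \sum_(0 <= j < J) v (y - j%:R * a).
have PB y : P y - P (y - a) = v y - v (y - J%:R * a).
  rewrite /P -sumrB -[RHS]opprB.
  pose f (j : nat) := v (y - j%:R * a).
  rewrite (_ : v y = f 0%N); last by rewrite /f mul0r subr0.
  rewrite -(telescope_sumr f (leq0n J)) -sumrN; apply: eq_bigr => j _.
  by rewrite opprB /f; congr (_ - v _); rewrite -[j.+1]addn1 natrD; ring.
have v_far y : y <= M -> v (y - J%:R * a) = 0.
  by move=> yM; apply: vM; rewrite lter_normr; apply/orP; right; lra.
pose g y := if y <= M then P y else 0.
have jJ (j : nat) : 0 <= j%:R * a by rewrite mulr_ge0// ltW.
exists g; split.
- move=> y; rewrite lter_normr /g => /orP[yM|yM]; first by rewrite leNgt yM.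
  rewrite ifT; last by lra.
  rewrite /P big1// => j _; apply: vM.
  by rewrite lter_normr; apply/orP; right; have := jJ j; lra.
- apply: measurable_fun_ifT => //.
    exact: measurable_fun_ler.
  apply: measurable_sum => j.
  by apply: (measurableT_comp mv); exact: measurable_shift.
move=> y Sy; rewrite /g; case: leP => yM; case: leP => yaM.
- by rewrite PB v_far// subr0.
- by lra.
- rewrite sub0r vM; last by rewrite (lt_le_trans yM)// ler_norm.
  (* Here [y - a <= M < y]: the terms missing from [P (y - a)] vanish, those with negative index
     lying beyond [M] and those with index at least [J] below [-M]. So [P (y - a)] is the full sum,
     of level zero. *)
  suff -> : P (y - a) = 0 by rewrite oppr0.
  rewrite -Sy /translate_sum.
  pose r := [seq j%:Z | j <- index_iota 0 J].
  have ur : uniq r by rewrite map_inj_uniq ?iota_uniq// => i j [].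
  transitivity (\sum_(k <- r) v (y - a - k%:~R * a)).
    by rewrite big_map; apply: eq_bigr => j _; rewrite -pmulrn.
  rewrite fsbig_seq//; apply: fsbig_widen => // k [_ /= kr].
  apply: vM; rewrite lter_normr.
  have [k0|k0] := leP 0 k.
    have kJ : J%:R <= k%:~R :> R.
      rewrite pmulrn ler_int leNgt; apply: contra_notN kr => kJ.
      by apply/mapP; exists (absz k); [rewrite mem_index_iota|]; lia.
    have := ler_wpM2r (ltW a0) kJ.
    by move=> ?; apply/orP; right; lra.
  have k1 : k%:~R <= (-1)%:~R :> R by rewrite ler_int; lia.
  have := ler_wpM2r (ltW a0) k1; rewrite mulrNz mulN1r.
  by move=> ?; apply/orP; left; lra.
- by rewrite subrr vM// (lt_le_trans yM)// ler_norm.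
Qed.

Lemma tile_levels_bounded u a b p q N M : 0 < a -> 0 < b ->
  measurable_fun setT u -> measurable N -> mu N = 0%E ->
  (forall x, ~ N x -> tiles_at u a p x /\ tiles_at u b q x) ->
  vanishes_beyond M u -> p * a = q * b.
Proof.
move=> a0 b0 mfu mN N0 tile uM.
have [Om [mOm Om0 aOm bOm OmN]] := conull_invariant a b mN N0.
(* A nonnegative bound common to the supports of [u] and of the trapezoid. *)
pose M' := `|M| + (a + b).
have uM' : vanishes_beyond M' u.
  by apply: vanishesW uM; have := ler_norm M; rewrite /M'; lra.
(* The factor gives [w] the level [p] along [a], matching [u]. *)
pose w x := p / b * trapezoid a b x.
have wM' : vanishes_beyond M' w.
  apply: (@vanishesW _ (a + b)); first by rewrite lerDr.
  by move=> x /(trapezoid_vanishes a0 b0); rewrite /w => ->; rewrite mulr0.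
have mw : measurable_fun setT w.
  apply: measurable_funM => //; apply: measurable_funB.
    exact: measurable_clip.
  by apply: (measurableT_comp (measurable_clip b)); exact: measurable_shift.
have wa x : translate_sum a w x = p.
  rewrite /translate_sum -mulr_fsumr -/(translate_sum a (trapezoid a b) x).
  by rewrite trapezoid_sum// divfK// gt_eqF.
have wb x : translate_sum b w x = p / b * a.
  rewrite /translate_sum -mulr_fsumr -/(translate_sum b (trapezoid a b) x).
  rewrite (_ : trapezoid a b = trapezoid b a) ?trapezoid_sum//.
  by apply/funext => y; exact: trapezoidC.
pose v := u \- w; pose r := q - p / b * a.
have vM' : vanishes_beyond M' v.
  by move=> x xM; rewrite /v/= uM'// wM'// subr0.
have mv : measurable_fun setT v by exact: measurable_funB.
have ua x : Om x -> translate_sum a u x = p.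
  move=> /OmN/tile[[_ ux] _]; apply: net_sum_finite => //.
  exact: translate_sum_finite uM'.
have ub x : Om x -> translate_sum b u x = q.
  move=> /OmN/tile[_ [_ ux]]; apply: net_sum_finite => //.
  exact: translate_sum_finite uM'.
have va x : Om x -> translate_sum a v x = 0.
  by move=> Ox; rewrite (translate_sumB _ a0 uM' wM') ua// wa subrr.
have vb x : Om x -> translate_sum b v x = r.
  by move=> Ox; rewrite (translate_sumB _ b0 uM' wM') ub// wb.
have M'0 : 0 <= M' by rewrite addr_ge0// ltW// addr_gt0.
have [g [gM mg gE]] := potential a0 M'0 vM' mv.
have Oma x : Om x -> Om (x - a).
  by move=> Ox; have := aOm _ 1 Ox; rewrite mul1r.
pose ga y := g (y - a).
have gaM : vanishes_beyond (M' + a) ga.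
  move=> y yM; apply: gM; have := ler_normD (y - a) a.
  by rewrite subrK (gtr0_norm a0); lra.
have gM2 : vanishes_beyond (M' + a) g by apply: vanishesW gM; rewrite lerDl ltW.
suff r0 : r = 0.
  move/eqP: r0; rewrite subr_eq0 => /eqP ->.
  by rewrite mulrAC divfK// gt_eqF.
apply: (@no_drift _ (translate_sum b g) a b r Om) => //.
- exact: measurable_translate_sum gM mg.
- by move=> x k; exact: translate_sum_shift.
(* Periodizing [g - g (. - a) = v] along [b] shows that the [b]-periodization of [g] drops by [r]
   under the shift by [a]. *)
- move=> x Ox; rewrite -(vb _ Ox).
  have -> : translate_sum b g (x - a) = translate_sum b ga x.
    by apply: eq_fsbigr => k _; congr g; ring.
  have -> : translate_sum b v x = translate_sum b (g \- ga) x.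
    apply: eq_fsbigr => k _; rewrite /= gE//; apply: va.
    exact/Oma/bOm.
  by rewrite (translate_sumB _ b0 gM2 gaM) subKr.
Qed.

End BoundedTiling.

(** * From Lebesgue measurable complex functions to real Borel ones *)

Section Reduction.
Context {R : realType}.
Local Notation mu := (@lebesgue_measure R).
Implicit Types (a b c x y t p q r M : R) (A E N Om : set R) (u v : R -> R).

Lemma lebesgue_measurableP (E : set (lebesgueTypeR R)) : measurable E ->
  exists A N : set R, [/\ measurable A, measurable N, mu N = 0%E,
    A `<=` E & E `<=` A `|` N].
Proof.
rewrite -[X in X -> _]/((wlength idfun)^*%mu.-cara.-measurable E).
rewrite -completed_caratheodory_measurable g_sigma_completed_algebra_genE.
move=> [A mA [Z [N [mN N0 ZN]] <-]]; exists A, N; split => //.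
exact: setUS.
Qed.

Lemma ae_lebesgue (P : R -> Prop) : (\forall x \ae mes, P x) ->
  exists N, [/\ measurable N, mu N = 0%E & forall x, ~ N x -> P x].
Proof.
move=> [E [mE E0 PE]]; have [A [N [mA mN N0 AE EAN]]] := lebesgue_measurableP mE.
exists (A `|` N); split; first exact: measurableU.
  rewrite measureU0//; apply/eqP; rewrite -measure_le0 -E0.
  exact: le_outer_measure.
by move=> x; apply: contra_notP => Px; apply/EAN/PE.
Qed.

(* [u] is only Lebesgue measurable: each rational superlevel set is Borel up to a
   null set, and removing the countable union of these null sets suffices. *)
Lemma borel_modification u : measurable_fun [set: lebesgueTypeR R] u ->
  exists N, [/\ measurable N, mu N = 0%E &
    forall Om, measurable Om -> (forall x, Om x -> ~ N x) ->
      measurable_fun setT (fun x => u x * \1_Om x)].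
Proof.
move=> mfu.
have lvl (r : rat) : measurable ([set x | ratr r < u x] : set (lebesgueTypeR R)).
  rewrite (_ : [set x | _] = setT `&` u @^-1` `]ratr r, +oo[).
    by apply: mfu => //; exact: measurable_itv.
  by rewrite setTI; apply/seteqP; split => x /=; rewrite in_itv/= andbT.
have /choice[A] := fun r : rat => lebesgue_measurableP (lvl r).
move=> /choice[B AB].
pose F n := if choice.unpickle n is Some r then B r else set0.
have FB (r : rat) : B r `<=` \bigcup_n F n.
  have [n rn] : exists n, choice.unpickle n = Some r.
    by exists (choice.pickle r); rewrite choice.pickleK.
  by move=> x Bx; exists n => //; rewrite /F rn.
exists (\bigcup_n F n); split.
- apply: bigcupT_measurable => n.
  by rewrite /F; case: choice.unpickle => // r; have [] := AB r.
- apply: measure_negligible.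
    apply: bigcupT_measurable => n.
    by rewrite /F; case: choice.unpickle => // r; have [] := AB r.
  apply: negligible_bigcup => n; rewrite /F.
  case: choice.unpickle => [r|]; last exact: negligible_set0.
  by have [_ mB B0 _ _] := AB r; exists (B r); split.
move=> Om mOm OmF.
have mE c : measurable ([set x | c < u x] `&` Om).
  (* A real superlevel set is the union of the rational ones above it, and on [Om] these are
     Borel. *)
  pose G (r : rat) := if c < ratr r then A r `&` Om else set0.
  rewrite (_ : _ `&` _ = \bigcup_r G r).
    apply: countable_bigcupT_measurable => // r; rewrite /G.
    by case: ifP => // _; apply: measurableI => //; have [] := AB r.
  apply/seteqP; split=> [x [/= cu Ox]|x [r _]].
    have [r] := rat_in_itvoo cu; rewrite in_itv/= => /andP[cr ru].
    exists r => //; rewrite /G cr; split => //.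
    have [_ _ _ _ /(_ x ru)[//|Bx]] := AB r.
    by case: (OmF _ Ox); exact: FB Bx.
  rewrite /G; case: ifP => // cr [Ax Ox]; split => //=.
  by have [_ _ _ /(_ x Ax) /= ru _] := AB r; exact: lt_trans ru.
apply: (measurability _ (RGenOInfty.measurableE R)) => _ [_ [c ->] <-].
(* Off [Om] the function is zero, so the complement of [Om] belongs to the superlevel set exactly
   when [c] is negative. *)
rewrite setTI; have [c0|c0] := ltP c 0.
  rewrite (_ : _ @^-1` _ = ([set x | c < u x] `&` Om) `|` ~` Om).
    by apply: measurableU => //; exact: measurableC.
  apply/seteqP; split => x /=; rewrite in_itv/= andbT indicE.
    by have [Ox|Ox] := pselect (Om x);
      [rewrite mem_set// mulr1; left|right].
  by move=> [[cu Ox]|Ox]; [rewrite mem_set// mulr1|rewrite memNset// mulr0].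
rewrite (_ : _ @^-1` _ = [set x | c < u x] `&` Om)//.
apply/seteqP; split => x /=; rewrite in_itv/= andbT indicE.
  have [Ox|Ox] := pselect (Om x); first by rewrite mem_set// mulr1.
  by rewrite memNset// mulr0 ltNge c0.
by move=> [cu Ox]; rewrite mem_set// mulr1.
Qed.

(** Multiply [u] by the indicator of an invariant conull set: the sums at its points do not change.
    The last clause carries sign, domination and support over to [v]. *)
Lemma lebesgue_tiling_reduction u a b p q :
  measurable_fun [set: lebesgueTypeR R] u ->
  (\forall x \ae mes, tiles_at u a p x) -> (\forall x \ae mes, tiles_at u b q x) ->
  exists v N, [/\ measurable_fun setT v, measurable N, mu N = 0%E,
    forall x, ~ N x -> tiles_at v a p x /\ tiles_at v b q x &
    forall x, v x = u x \/ v x = 0].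
Proof.
move=> mfu /ae_lebesgue[Na [mNa Na0 ta]] /ae_lebesgue[Nb [mNb Nb0 tb]].
have [N [mN N0 bu]] := borel_modification mfu.
have [Om [mOm Om0 aOm bOm OmN]] : exists Om, [/\ measurable Om, mu (~` Om) = 0%E,
    periodic a Om, periodic b Om & forall x, Om x -> ~ (N `|` (Na `|` Nb)) x].
  apply: conull_invariant; first by do 2 apply: measurableU => //.
  by rewrite !measureU0//; exact: measurableU.
pose v x := u x * \1_Om x; exists v, (~` Om); split => //.
- by apply: bu => // x /OmN /not_orP[].
- exact: measurableC.
- move=> x /contrapT Ox.
  have tE c r : periodic c Om -> tiles_at u c r x -> tiles_at v c r x.
    move=> cOm; have vE (k : int) : v (x - k%:~R * c) = u (x - k%:~R * c).
      by rewrite /v indicE mem_set ?mulr1//; exact: cOm.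
    by rewrite /tiles_at -(funext vE); under [X in _ -> summable _ X /\ _]eq_fun
      do rewrite vE.
  have /not_orP[_ /not_orP[/ta Ta /tb Tb]] := OmN _ Ox.
  by split; exact: tE.
- move=> x; rewrite /v indicE; case: (x \in Om); first by left; rewrite mulr1.
  by right; rewrite mulr0.
Qed.

Lemma normr_Re_le (z : R[i]) : `|complex.Re z| <= ComplexField.Normc.normc z.
Proof.
by case: z => x y /=; rewrite -sqrtr_sqr ler_wsqrtr// lerDl sqr_ge0.
Qed.

Lemma normr_Im_le (z : R[i]) : `|complex.Im z| <= ComplexField.Normc.normc z.
Proof.
by case: z => x y /=; rewrite -sqrtr_sqr ler_wsqrtr// lerDr sqr_ge0.
Qed.

Lemma sums_toP (w : int -> R[i]) (s : R[i]) : sums_to w s ->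
  forall e : R, 0 < e -> exists A : {fset int}, forall B : {fset int},
    (A `<=` B)%fset -> ComplexField.Normc.normc (\sum_(i <- B) w i - s) < e.
Proof.
move=> ws e e0.
have /(_ e%:C%C) := (@cvgrPdist_lt R[i] R[i]^o _ _ (@filter_filter _ _
  summability.totally_filter) (summability.partial_sum w) s).1 ws.
have -> : 0 < e%:C%C by rewrite ltcR.
move=> /(_ isT)[A _ hA]; exists A => B /hA.
rewrite /summability.partial_sum distrC -(big_seq_fsetE _ B xpredT w)/=.
by rewrite -ltcR.
Qed.

Lemma tiles_at_Re_Im (f : R -> R[i]) a (p : R[i]) x :
  absolutely_convergent (fun k : int => f (x - k%:~R * a)) ->
  sums_to (fun k : int => f (x - k%:~R * a)) p ->
  tiles_at (fun y => complex.Re (f y)) a (complex.Re p) x /\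
  tiles_at (fun y => complex.Im (f y)) a (complex.Im p) x.
Proof.
move=> absf /sums_toP sf; split; split.
- apply: le_lt_trans absf; apply: le_esum => k _.
  by rewrite !abse_EFin lee_fin (le_trans (normr_Re_le _))// ler_norm.
- move=> e /sf[A hA]; exists A => B /hA; apply: le_lt_trans.
  apply: le_trans (normr_Re_le _); rewrite raddfB/= raddf_sum.
  exact: lexx.
- apply: le_lt_trans absf; apply: le_esum => k _.
  by rewrite !abse_EFin lee_fin (le_trans (normr_Im_le _))// ler_norm.
- move=> e /sf[A hA]; exists A => B /hA; apply: le_lt_trans.
  apply: le_trans (normr_Im_le _); rewrite raddfB/= raddf_sum.
  exact: lexx.
Qed.


(** The identity from the Lebesgue to the Borel sigma-algebra is measurable and pushes [mes] forward
    to [mu]. *)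
Lemma integrable_completed v (g : R -> R) :
  measurable_fun setT v -> mes.-integrable [set: lebesgueTypeR R] (EFin \o g) ->
  (forall x, `|v x| <= g x) -> mu.-integrable setT (EFin \o v).
Proof.
move=> mv /integrableP[mg goo] vg.
pose phi : lebesgueTypeR R -> measurableTypeR R := fun x => x.
have mphi : measurable_fun setT phi.
  by move=> _ Y mY; rewrite setTI; exact: sub_caratheodory.
apply/integrableP; split; first exact/measurable_EFinP.
have mabs : measurable_fun setT (fun x : R => `|(EFin \o v) x|%E).
  by apply: measurableT_comp => //; exact/measurable_EFinP.
have -> : (\int[mu]_x `|(EFin \o v) x| =
    \int[pushforward mes phi]_(x in [set: R]) `|(EFin \o v) x|)%E.
  by apply: eq_measure_integral => A mA _.
rewrite (ge0_integral_pushforward mphi)// preimage_setT.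
apply: le_lt_trans goo; apply: ge0_le_integral => //.
- by move=> x _ /=.
- exact: (measurableT_comp mabs mphi).
- exact: measurableT_comp.
- move=> x _; rewrite /= lee_fin (le_trans (vg x))//; exact: ler_norm.
Qed.

(** A dominating [g] stands in for integrability of [u], since the real and imaginary parts of [f]
    are to be dominated by its modulus. *)
Lemma real_tiling u a b p q : 0 < a -> 0 < b ->
  measurable_fun [set: lebesgueTypeR R] u ->
  (\forall x \ae mes, tiles_at u a p x) -> (\forall x \ae mes, tiles_at u b q x) ->
  [\/ forall x, 0 <= u x,
      exists2 g : R -> R, mes.-integrable [set: lebesgueTypeR R] (EFin \o g) &
        forall x, `|u x| <= g x |
      exists M, vanishes_beyond M u] ->
  p * a = q * b /\
  (p != 0 -> rationally_independent a b -> ((a + b)%:E <= mes (ssupp u))%E).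
Proof.
move=> a0 b0 mfu ta tb uH.
have [v [N [mv mN N0 tv vu]]] := lebesgue_tiling_reduction mfu ta tb.
have pq : p * a = q * b.
  case: uH => [u0|[g ig ug]|[M uM]].
  - apply: (tile_levels_integral a0 b0 mv mN N0 tv); left => x.
    by case: (vu x) => ->.
  - apply: (tile_levels_integral a0 b0 mv mN N0 tv); right.
    apply: integrable_completed ig _ => // x; case: (vu x) => -> //.
    by rewrite normr0 (le_trans _ (ug x)).
  - apply: (@tile_levels_bounded _ v a b p q N M) => // x /uM ux.
    by case: (vu x) => ->.
split => // p0 ind.
apply: (@le_trans _ _ (mu (ssupp v))); last first.
  apply: (@le_outer_measure _ _ (wlength idfun)^*%mu).
  by move=> x; rewrite /ssupp/=; case: (vu x) => ->//; rewrite eqxx.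
apply: (le_support a0 b0 _ mv mN N0 tv) => n m nm.
(* Multiplied by [p], this follows from [p n = q m] and [p a = q b]; thus independence of [a] and
   [b] passes to [p] and [q]. *)
have /ind[/eqP] : (- m%:Z)%:~R * a + n%:Z%:~R * b = 0.
  apply: (mulfI p0); rewrite mulr0 mulrNz -!pmulrn.
  rewrite -[p *+ n]mulr_natr -[q *+ m]mulr_natr in nm.
  transitivity ((p * n%:R) * b - (p * a) * m%:R); first by ring.
  by rewrite nm pq; ring.
by rewrite oppr_eq0 => /eqP [->] [->].
Qed.

End Reduction.

(** * The theorem for complex-valued functions *)

Local Open Scope complex_scope.

Theorem corollary2p4 (R : realType) (f : R -> R[i]) (a b : R) (p q : R[i]) :
  lebesgue_measurable f ->
  (forall x, 0 <= f x) \/ in_L1 f \/ bounded_set (supp f) ->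
  0 < a -> 0 < b -> rationally_independent a b ->
  sum_translates_ae f a p -> sum_translates_ae f b q ->
  (p, q) <> (0, 0) ->
  proportional (p, q) (b%:C, a%:C) /\ ((a + b)%:E <= mes (supp f))%E.
Proof.
move=> [mRe mIm] fH a0 b0 ind fa fb pq0.
have split_ae c r : sum_translates_ae f c r ->
    (\forall x \ae mes, tiles_at (fun y => complex.Re (f y)) c (complex.Re r) x) /\
    (\forall x \ae mes, tiles_at (fun y => complex.Im (f y)) c (complex.Im r) x).
  move=> fc; split; move: fc;
  by (apply: filterS; first exact: (ae_filter_ringOfSetsType mes)) => x [h1 h2];
  have [] := tiles_at_Re_Im h1 h2.
have [ra ia] := split_ae _ _ fa; have [rb ib] := split_ae _ _ fb.
have bounded_supp : bounded_set (supp f) -> exists M, forall x, M < `|x| -> f x = 0.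
  move=> [M [_ /(_ (M + 1))]]; rewrite ltrDl => /(_ ltr01) fM.
  exists (M + 1) => x; apply: contraTeq => fx.
  by rewrite -leNgt; exact: fM.
have [re1 re2] : complex.Re p * a = complex.Re q * b /\ (complex.Re p != 0 ->
    rationally_independent a b ->
    ((a + b)%:E <= mes (ssupp (fun x => complex.Re (f x))))%E).
  apply: (real_tiling a0 b0 mRe ra rb); case: fH => [f0|[[_ fL]|/bounded_supp[M fM]]].
  - by apply: Or31 => x; have := f0 x; rewrite lecE => /andP[].
  - apply: Or32; eexists; first exact: fL.
    by move=> x; exact: normr_Re_le.
  - by apply: Or33; exists M => x /fM ->.
have [im1 im2] : complex.Im p * a = complex.Im q * b /\ (complex.Im p != 0 ->
    rationally_independent a b ->
    ((a + b)%:E <= mes (ssupp (fun x => complex.Im (f x))))%E).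
  apply: (real_tiling a0 b0 mIm ia ib); case: fH => [f0|[[_ fL]|/bounded_supp[M fM]]].
  (* In the order on complex numbers, a nonnegative value has zero imaginary part. *)
  - by apply: Or31 => x; have := f0 x; rewrite lecE => /andP[/eqP ->].
  - apply: Or32; eexists; first exact: fL.
    by move=> x; exact: normr_Im_le.
  - by apply: Or33; exists M => x /fM ->.
have pqC : p * a%:C = q * b%:C.
  move: re1 im1; case: (p) (q) => [p1 p2] [q1 q2] /= re1 im1.
  by apply/eqP; rewrite eq_complex /= !mulr0 !subr0 !add0r re1 im1 !eqxx.
have bC : b%:C != 0 by rewrite (inj_eq (@complexI _)) gt_eqF.
split.
  exists (p / b%:C) => /=; split; first by rewrite divfK.
  by rewrite mulrAC pqC mulfK.
have p0 : p != 0.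
  apply/eqP => p0; apply: pq0; rewrite p0; congr (_, _).
  by move/eqP: pqC; rewrite p0 mul0r eq_sym mulf_eq0 (negbTE bC) orbF => /eqP.
have sub (h : R[i] -> R) : h 0 = 0 ->
    (mes (ssupp (fun x => h (f x))) <= mes (supp f))%E.
  move=> h0; apply: (@le_outer_measure _ _ (wlength idfun)^*%mu) => x.
  by rewrite /ssupp/=; apply: contra_neq => ->.
(* One of the two parts of [p] is nonzero; the bound for that part of [f] suffices, its support
   lying in that of [f]. *)
have [rp0|rp0] := eqVneq (complex.Re p) 0; last first.
  by apply: le_trans (re2 rp0 ind) _; exact: (sub (@complex.Re R) erefl).
have ip0 : complex.Im p != 0.
  apply: contra_neq p0 => ip0.
  by apply/eqP; rewrite eq_complex rp0 ip0 !eqxx.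
by apply: le_trans (im2 ip0 ind) _; exact: (sub (@complex.Im R) erefl).
Qed.
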